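(* Let $\mathbb X=\mathbb X_1\oplus\mathbb X_2$ be a Hilbert space, let $\mathcal A=\begin{bmatrix}\mathcal A_1\\ \mathcal A_2\end{bmatrix}:D(\mathcal A)\subseteq\mathbb X\to\mathbb X_1\oplus\mathbb X_2$ be a dissipative linear operator, and let $$\mathcal E=\begin{bmatrix}\mathcal E_1&0\\ 0&0\end{bmatrix},\qquad \mathcal Q=\begin{bmatrix}\mathcal Q_1&0\\ 0&\mathcal Q_2\end{bmatrix},$$ where $\mathcal E_1,\mathcal Q_1$ (on $\mathbb X_1$) and $\mathcal Q_2$ (on $\mathbb X_2$) are bounded and boundedly invertible and $\mathcal E_1^*\mathcal Q_1$ is coercive. Assume that the pair $(\mathcal E,\mathcal A\mathcal Q)$ is regular, and that whenever $\begin{bmatrix}0\\ x_2\end{bmatrix}\in D(\mathcal A)$ is such that $\mathcal A_2\begin{bmatrix}0\\ x_2\end{bmatrix}=0$, then $x_2=0$. Let $\mathbb X_{1,\mathcal E\mathcal Q}$ denote the space $\mathbb X_1$ equipped with the inner product $\langle x_1,\tilde x_1\rangle_{\mathcal E\mathcal Q}=\langle x_1,\mathcal E_1^*\mathcal Q_1\tilde x_1\rangle$. Define $\mathcal A_{red}:D(\mathcal A_{red})\subset\mathbb X_{1,\mathcal E\mathcal Q}\to\mathbb X_{1,\mathcal E\mathcal Q}$ by $$D(\mathcal A_{red})=\left\{x_1\in\mathbb X_{1,\mathcal E\mathcal Q}\ \middle|\ \exists\,x_2\in\mathbb X_2:\ \begin{bmatrix}\mathcal Q_1x_1\\ \mathcal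 Q_2x_2\end{bmatrix}\in D(\mathcal A)\text{ and }\mathcal A_2\begin{bmatrix}\mathcal Q_1x_1\\ \mathcal Q_2x_2\end{bmatrix}=0\right\},$$ $$\mathcal A_{red}x_1=\mathcal E_1^{-1}\mathcal A_1\begin{bmatrix}\mathcal Q_1x_1\\ \mathcal Q_2x_2\end{bmatrix},\qquad x_1\in D(\mathcal A_{red}),$$ with $x_2$ as in the definition of the domain. Then $\mathcal A_{red}$ (is well-defined and) generates a contraction semigroup on $\mathbb X_{1,\mathcal E\mathcal Q}$.
   Context: Hilbert spaces are complex; $\mathbb C^+=\{s\in\mathbb C:\operatorname{Re}s>0\}$. A linear operator $\mathcal A$ is dissipative if $\operatorname{Re}\langle\mathcal Ax,x\rangle\le0$ for all $x\in D(\mathcal A)$. A bounded operator $T$ is coercive if it is self-adjoint and there is $\kappa>0$ with $\langle Tx,x\rangle\ge\kappa\|x\|^2$ for all $x$. The operator $s\mathcal E-\mathcal A\mathcal Q$ has domain $\{x\in\mathbb X:\mathcal Qx\in D(\mathcal A)\}$; an operator is boundedly invertible if it is a bijection from its domain onto the whole space with bounded inverse. The pair $(\mathcal E,\mathcal A\mathcal Q)$ is regular if there exists $s\in\mathbb C^+$ such that $s\mathcal E-\mathcal A\mathcal Q$ is boundedly invertible. A contraction semigroup is a strongly continuous semigroup $(T(t))_{t\ge0}$ with $\|T(t)\|\le1$ for all $t\ge 0$. *)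

(* Defs.v *)
From HB Require Import structures.
From mathcomp Require Import all_boot all_order all_algebra.
From mathcomp Require Import complex.
From mathcomp Require Import boolp classical_sets functions reals topology normedtype.
Set Implicit Arguments.
Unset Strict Implicit.
Unset Printing Implicit Defensive.
Import Order.TTheory GRing.Theory Num.Theory.
Import numFieldNormedType.Exports.
Local Open Scope classical_set_scope.
Local Open Scope ring_scope.
Local Open Scope complex_scope.

(* A complex Hilbert space is an instance at [C := R[i]], [R : realType].
   The form is linear in its first argument, conjugate-linear in the second. *)
HB.mixin Record CompleteNormedModule_isHilbert (C : numClosedFieldType) H
    & CompleteNormedModule C H := {
  inner : {dot H for Num.conj} ;
  innerE : forall x : H, inner x x = `|x| ^+ 2
}.

#[short(type="hilbertType")]
HB.structure Definition Hilbert (C : numClosedFieldType) :=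
  {H of CompleteNormedModule C H & CompleteNormedModule_isHilbert C H}.

Section dot_norm.
Variables (C : numClosedFieldType) (U : lmodType C) (f : {dot U for Num.conj}).

Definition dot_norm (u : U) : C := sqrtC (f u u).

Lemma dot_CS u v : `|f u v| ^+ 2 <= f u u * f v v.
Proof.
have [->|v0] := eqVneq v 0.
  by rewrite !linear0r normr0 expr0n/= mulr0.
have fv : 0 < f v v by rewrite dnorm_gt0.
pose a := f u v / f v v; pose w := u - a *: v.
have wv : f w v = 0.
  by rewrite /w linearBl/= linearZl_LR /a divfK ?subrr// gt_eqF.
have uE : u = w + a *: v by rewrite /w subrK.
have fuE : f u u = f w w + `|a| ^+ 2 * f v v.
  rewrite {1 2}uE dnormD dnormZ /= linearZr_LR /= wv mulr0 conjC0 addr0.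
  by rewrite addr0.
rewrite fuE mulrDl -mulrA -expr2 /a normrM normfV (gtr0_norm fv) exprMn exprVn.
by rewrite mulfVK ?expf_neq0 ?gt_eqF// lerDr mulr_ge0 ?dnorm_ge0// ltW.
Qed.

Lemma dot_norm_ge0 u : 0 <= dot_norm u.
Proof. by rewrite sqrtC_ge0 dnorm_ge0. Qed.

Lemma dot_normK u : dot_norm u ^+ 2 = f u u.
Proof. by rewrite sqrtCK. Qed.

Lemma dot_normD u v : dot_norm (u + v) <= dot_norm u + dot_norm v.
Proof.
rewrite -ler_sqr ?nnegrE ?addr_ge0 ?dot_norm_ge0//.
rewrite sqrrD !dot_normK dnormD /= [leRHS]addrAC lerD2l -mulr_natr.
have -> : f u v + (f u v)^* = 'Re (f u v) * 2%:R.
  by rewrite ReE divfK// pnatr_eq0.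
rewrite ler_pM2r ?ltr0n//; apply: (le_trans (leif_Re_Creal (f u v))).
rewrite -ler_sqr ?nnegrE ?mulr_ge0 ?dot_norm_ge0// exprMn !dot_normK.
exact: dot_CS.
Qed.

Lemma dot_normZ a u : dot_norm (a *: u) = `|a| * dot_norm u.
Proof.
apply/eqP; rewrite -(@eqrXn2 _ 2)// ?mulr_ge0 ?dot_norm_ge0//.
by rewrite exprMn !dot_normK dnormZ.
Qed.

Lemma dot_norm_eq0 u : dot_norm u = 0 -> u = 0.
Proof. by move=> /eqP; rewrite sqrt_dnorm_eq0 => /eqP. Qed.

End dot_norm.

Lemma lipschitz_cauchy (K : numFieldType) (U V : normedModType K) (f : U -> V)
    (M : K) (F : set_system U) : ProperFilter F -> 0 < M ->
  (forall x y, `|f x - f y| <= M * `|x - y|) -> cauchy F -> cauchy (f @ F).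
Proof.
move=> FF M0 lipf /cauchyP cF; apply/cauchyP => e e0.
have [x Fx] := cF (e / M) (divr_gt0 e0 M0).
exists (f x); rewrite /fmap /nbhs /=; apply: filterS Fx => y.
rewrite -!ball_normE /ball_ /= => xy; apply: le_lt_trans (lipf x y) _.
by rewrite mulrC -ltr_pdivlMr.
Qed.

(* An alias is needed because [X1 * X2] already carries the max norm. *)
Definition hsum (C : numClosedFieldType) (X1 X2 : hilbertType C) : Type := (X1 * X2)%type.

Section hsum.
Variables (C : numClosedFieldType) (X1 X2 : hilbertType C).
Local Notation X := (hsum X1 X2).

HB.instance Definition _ := GRing.Lmodule.copy X (X1 * X2)%type.

Definition hsum_dot (x y : X) : C := inner x.1 y.1 + inner x.2 y.2.

Fact hsum_dot_bilinear : bilinear_for *%R (Num.conj \; *%R) hsum_dot.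
Proof.
split=> u a x y /=; rewrite /hsum_dot /=.
  rewrite !linearDl /= !linearZl_LR mulrDr.
  exact: addrACA.
rewrite !linearDr /= !linearZr_LR /= mulrDr.
exact: addrACA.
Qed.
HB.instance Definition _ := bilinear_isBilinear.Build C X X C _ _ hsum_dot
  hsum_dot_bilinear.

Fact hsum_dotC x y : hsum_dot x y = (-1) ^+ false * Num.conj (hsum_dot y x).
Proof.
rewrite expr0 mul1r /hsum_dot rmorphD/=.
by rewrite (hermC _ x.1) (hermC _ x.2)/= !expr0 !mul1r.
Qed.
HB.instance Definition _ := isHermitianSesquilinear.Build C X false Num.conj
  hsum_dot hsum_dotC.

Fact hsum_dot_gt0 x : x != 0 -> 0 < hsum_dot x x.
Proof.
case: x => x y xy0; rewrite lt0r /hsum_dot /= addr_ge0 ?dnorm_ge0// andbT.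
rewrite paddr_eq0 ?dnorm_ge0// !dnorm_eq0.
by apply: contra xy0 => /andP[/eqP-> /eqP->].
Qed.
HB.instance Definition _ := isDotProduct.Build C X hsum_dot hsum_dot_gt0.

HB.instance Definition _ := Lmodule_isNormed.Build C X
  (dot_normD hsum_dot) (dot_normZ hsum_dot) (@dot_norm_eq0 _ _ hsum_dot).

Fact hsum_normE (x : X) : `|x| ^+ 2 = `|x.1| ^+ 2 + `|x.2| ^+ 2.
Proof. by rewrite -!innerE; exact: (dot_normK hsum_dot). Qed.

Fact hsum_complete (F : set_system X) : ProperFilter F -> cauchy F -> cvg F.
Proof.
move=> FF cF.
have n1 (z : X) : `|z.1| <= `|z|.
  by rewrite -ler_sqr ?nnegrE// hsum_normE lerDl exprn_ge0.
have n2 (z : X) : `|z.2| <= `|z|.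
  by rewrite -ler_sqr ?nnegrE// hsum_normE lerDr exprn_ge0.
have n12 (z : X) : `|z| <= `|z.1| + `|z.2|.
  rewrite -ler_sqr ?nnegrE ?addr_ge0// hsum_normE sqrrD addrAC lerDl.
  by rewrite mulrn_wge0// mulr_ge0.
have /cauchy_cvg /cvg_ex[l1 /= Fl1] : cauchy ((fst : X -> X1) @ F).
  by apply: (lipschitz_cauchy (M := 1)) cF => // x y; rewrite mul1r; exact: (n1 (x - y)).
have /cauchy_cvg /cvg_ex[l2 /= Fl2] : cauchy ((snd : X -> X2) @ F).
  by apply: (lipschitz_cauchy (M := 1)) cF => // x y; rewrite mul1r; exact: (n2 (x - y)).
apply/cvg_ex; exists ((l1, l2) : X); apply/cvgrPdist_lt => e e0.
have e20 : 0 < e / 2%:R by rewrite divr_gt0.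
move/cvgrPdist_lt : Fl1 => /(_ _ e20) Fl1.
move/cvgrPdist_lt : Fl2 => /(_ _ e20) Fl2.
near=> x.
rewrite (le_lt_trans (n12 _))//= [e]splitr ltrD//.
  by near: x; exact: Fl1.
by near: x; exact: Fl2.
Unshelve. all: by end_near. Qed.
HB.instance Definition _ := Uniform_isComplete.Build X hsum_complete.

Fact hsum_innerE (x : X) : hsum_dot x x = `|x| ^+ 2.
Proof. by rewrite hsum_normE -!innerE. Qed.
HB.instance Definition _ := CompleteNormedModule_isHilbert.Build C X hsum_innerE.
End hsum.

Section operators.
Variable C : numClosedFieldType.

Definition bounded_op (X Y : hilbertType C) (f : X -> Y) :=
  exists M : C, forall x, `|f x| <= M * `|x|.

Definition adjoint_pair (X : hilbertType C) (f g : X -> X) :=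
  forall x y, inner (f x) y = inner x (g y).

(* The adjoint of a bounded operator exists (Riesz) and is unique. *)
Definition adjoint (X : hilbertType C) (f : X -> X) : X -> X :=
  xget (fun=> 0) [set g | adjoint_pair f g].

Record coercive (X : hilbertType C) (W : X -> X) : Prop := Coercive {
  coercive_bounded : bounded_op W ;
  coercive_selfadjoint : adjoint_pair W W ;
  coercive_ge : exists2 k : C, 0 < k & forall x, k * `|x| ^+ 2 <= inner (W x) x
}.
End operators.

(* [X] with the inner product [inner x (W y)], and its norm and topology. *)
Definition weighted (C : numClosedFieldType) (X : hilbertType C) (W : X -> X)
  (hW : coercive W) : Type := X.

Section weighted.
Variables (C : numClosedFieldType) (X : hilbertType C) (W : X -> X) (hW : coercive W).
Local Notation XW := (weighted hW).

HB.instance Definition _ := GRing.Lmodule.copy XW X.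

Definition weighted_dot (x y : XW) : C := inner (x : X) (W y).

Fact weighted_dot_bilinear : bilinear_for *%R (Num.conj \; *%R) weighted_dot.
Proof.
split=> u a x y /=; rewrite /weighted_dot /=.
  by rewrite linearDl /= linearZl_LR.
rewrite -!(coercive_selfadjoint hW).
by rewrite linearDr /= linearZr_LR.
Qed.
HB.instance Definition _ := bilinear_isBilinear.Build C XW XW C _ _
  weighted_dot weighted_dot_bilinear.

Fact weighted_dotC x y :
  weighted_dot x y = (-1) ^+ false * Num.conj (weighted_dot y x).
Proof.
rewrite /weighted_dot -(coercive_selfadjoint hW).
by rewrite (hermC _ (W x)).
Qed.
HB.instance Definition _ := isHermitianSesquilinear.Build C XW false Num.conj
  weighted_dot weighted_dotC.

Fact weighted_dot_gt0 x : x != 0 -> 0 < weighted_dot x x.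
Proof.
have [k k0 kW] := coercive_ge hW => x0.
rewrite /weighted_dot -(coercive_selfadjoint hW).
apply: lt_le_trans (kW _); rewrite mulr_gt0 // exprn_gt0// normr_gt0.
exact: x0.
Qed.
HB.instance Definition _ := isDotProduct.Build C XW weighted_dot
  weighted_dot_gt0.

HB.instance Definition _ := Lmodule_isNormed.Build C XW
  (dot_normD weighted_dot) (dot_normZ weighted_dot)
  (@dot_norm_eq0 _ _ weighted_dot).

Fact weighted_innerE (x : XW) : weighted_dot x x = `|x| ^+ 2.
Proof. by rewrite -(dot_normK weighted_dot). Qed.

Fact weighted_norm_ge : exists2 c : C, 0 < c & forall x : XW, `|(x : X)| <= c * `|x|.
Proof.
have [k k0 kW] := coercive_ge hW.
exists (sqrtC k)^-1 => [|x]; first by rewrite invr_gt0 sqrtC_gt0.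
rewrite ler_pdivlMl ?sqrtC_gt0// -ler_sqr ?nnegrE ?mulr_ge0 ?sqrtC_ge0 ?(ltW k0)//.
rewrite exprMn sqrtCK -weighted_innerE /weighted_dot -(coercive_selfadjoint hW).
exact: kW.
Qed.

Fact weighted_norm_le : exists2 c : C, 0 < c & forall x : XW, `|x| <= c * `|(x : X)|.
Proof.
have [M bW] := coercive_bounded hW.
have c0 : 0 < (`|M| + 1) by rewrite ltr_wpDl.
exists (sqrtC (`|M| + 1)) => [|x]; first by rewrite sqrtC_gt0.
rewrite -ler_sqr ?nnegrE ?mulr_ge0 ?sqrtC_ge0 ?(ltW c0)//.
rewrite exprMn [X in _ <= X * _]sqrtCK -weighted_innerE -[leLHS]ger0_norm ?dnorm_ge0//.
rewrite -ler_sqr ?nnegrE ?mulr_ge0 ?exprn_ge0 ?(ltW c0)//.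
apply: le_trans (dot_CS (inner : {dot X for Num.conj}) x (W x)) _.
rewrite !innerE -exprMn ler_sqr ?nnegrE ?mulr_ge0 ?exprn_ge0 ?(ltW c0)//.
rewrite mulrC expr2 mulrA ler_wpM2r//; have Mx := bW x.
rewrite (le_trans Mx)// -(ger0_norm (le_trans (normr_ge0 _) Mx)).
by rewrite normrM normr_id ler_wpM2r// lerDl.
Qed.

Fact weighted_complete (F : set_system XW) : ProperFilter F -> cauchy F -> cvg F.
Proof.
move=> FF cF; have [c c0 cP] := weighted_norm_ge; have [d d0 dP] := weighted_norm_le.
have /cauchy_cvg /cvg_ex[l /= /cvgrPdist_lt Fl] : cauchy ((id : XW -> X) @ F).
  by apply: (lipschitz_cauchy _ c0) cF => x y; exact: (cP (x - y)).
apply/cvg_ex; exists (l : XW); apply/cvgrPdist_lt => e e0.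
have {}Fl := Fl _ (divr_gt0 e0 d0).
near=> x.
rewrite (le_lt_trans (dP _))// mulrC -ltr_pdivlMr//.
by near: x; exact: Fl.
Unshelve. all: by end_near. Qed.
HB.instance Definition _ := Uniform_isComplete.Build XW weighted_complete.

HB.instance Definition _ :=
  CompleteNormedModule_isHilbert.Build C XW weighted_innerE.
End weighted.

(* A possibly unbounded operator; its values outside [opdom] are irrelevant. *)
Record partial_op (X Y : Type) := PartialOp { opdom : set X ; app :> X -> Y }.

Definition total_op (X Y : Type) (f : X -> Y) : partial_op X Y := PartialOp setT f.

Definition comp_op (X Y Z : Type) (A : partial_op Y Z) (Q : X -> Y) :
    partial_op X Z :=
  PartialOp [set x | opdom A (Q x)] (A \o Q).

Section unbounded_operators.
Variables (C : numClosedFieldType) (X : hilbertType C).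
Implicit Type A : partial_op X X.

Definition linear_op A :=
  opdom A 0 /\
  forall (a : C) x y, opdom A x -> opdom A y ->
    opdom A (a *: x + y) /\ A (a *: x + y) = a *: A x + A y.

Definition dissipative A := forall x, opdom A x -> 'Re (inner (A x) x) <= 0.

Definition inv_op A : X -> X := 'pinv_(fun=> 0) (opdom A) A.

Definition boundedly_invertible A :=
  set_bij (opdom A) setT A /\ bounded_op (inv_op A).

Definition pencil (s : C) (E : X -> X) (B : partial_op X X) : partial_op X X :=
  PartialOp (opdom B) (fun x => s *: E x - B x).

Definition regular (E : X -> X) (B : partial_op X X) :=
  exists2 s : C, 0 < 'Re s & boundedly_invertible (pencil s E B).
End unbounded_operators.

Section semigroups.
Variables (R : realType) (X : hilbertType R[i]).
Implicit Types (T : R -> {linear X -> X}) (A : partial_op X X).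

(* [T t] is only meaningful for [0 <= t]. Right continuity at [0] yields continuity
   of the orbits on the half-line. *)
Record contraction_semigroup T : Prop := ContractionSemigroup {
  semigroup0 : forall x, T 0 x = x ;
  semigroupD : forall s t, 0 <= s -> 0 <= t -> forall x, T (s + t) x = T s (T t x) ;
  semigroup_contraction : forall t, 0 <= t -> forall x, `|T t x| <= `|x| ;
  semigroup_strong_cvg : forall x, T t x @[t --> (0 : R)^'+] --> x
}.

Definition difference_quotient T (x : X) (t : R) : X := (t^-1)%:C *: (T t x - x).

Definition generator T : partial_op X X :=
  PartialOp [set x | cvg (difference_quotient T x @ (0 : R)^'+)]
    (fun x => lim (difference_quotient T x @ (0 : R)^'+)).

Definition generates_contraction_semigroup A :=
  exists T, [/\ contraction_semigroup T, opdom A = opdom (generator T) &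
    forall x, opdom A x -> A x = generator T x].
End semigroups.

Section block_operators.
Variables (C : numClosedFieldType) (X1 X2 : hilbertType C).
Local Notation X := (hsum X1 X2).

Definition block_diag (f1 : X1 -> X1) (f2 : X2 -> X2) (x : X) : X :=
  (f1 x.1, f2 x.2).

Variables (A : partial_op X X) (E1 Q1 : X1 -> X1) (Q2 : X2 -> X2).

Definition red_pair (x1 : X1) (x2 : X2) :=
  opdom A (Q1 x1, Q2 x2) /\ (A (Q1 x1, Q2 x2)).2 = 0.

Variable hW : coercive (adjoint E1 \o Q1).

(* The component [x2] of the definition of the domain is picked by choice. *)
Definition A_red : partial_op (weighted hW) (weighted hW) :=
  PartialOp [set x1 : weighted hW | exists x2, red_pair x1 x2]
    (fun x1 : weighted hW =>
       inv_op (total_op E1) (A (Q1 x1, Q2 (xget 0 (red_pair x1)))).1).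
End block_operators.

(* Main.v *)
Require Import Defs.
From HB Require Import structures.
From mathcomp Require Import all_boot all_order all_algebra.
From mathcomp Require Import complex.
From mathcomp Require Import boolp classical_sets functions reals topology normedtype.
From mathcomp Require Import sequences ring lra.
Set Implicit Arguments.
Unset Strict Implicit.
Unset Printing Implicit Defensive.
Import Order.TTheory GRing.Theory Num.Theory.
Import numFieldNormedType.Exports.
Local Open Scope classical_set_scope.
Local Open Scope ring_scope.
Local Open Scope complex_scope.

(** The weighted inner product is chosen so that
    <A_red x1, x1>_EQ = <A z, z> with z = (Q1 x1, Q2 x2) and A_2 z = 0, whence
    A_red is dissipative; solving (s E - A Q) x = (E1 f, 0) shows that
    s - A_red is onto for the s of the regularity assumption.

    What remains is the Lumer-Phillips theorem. Surjectivity propagates along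
    segments to the whole right half-plane by the contraction principle, and
    in a Hilbert space it forces the domain to be dense. With
    J_h = (1 - h A)^-1, the identity (1 - aA)(1 - bA) = 1 - (a + b)A + abA^2
    gives |J_(a+b) x - J_a J_b x| <= ab |A^2 x|. Telescoping commuting
    contractions, this yields both the convergence of the Euler scheme
    J_(t/2^n)^(2^n) x and the semigroup law of its limit. *)


(** * Real-valued norm and inner product on a complex Hilbert space *)

Section RealStructure.
Context {R : realType} {H : hilbertType R[i]}.
Implicit Types (x y z : H) (r : R).

(** The norm takes values in [R[i]], whose order is partial; its real part carries the same
    information in [R], where real arithmetic applies. *)
Definition rnorm x : R := complex.Re `|x|.
Definition rdot x y : R := complex.Re (inner x y).

Lemma rnormE x : `|x| = (rnorm x)%:C.
Proof. by rewrite /rnorm RRe_real// ger0_real. Qed.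

Lemma rnorm_ge0 x : 0 <= rnorm x.
Proof. by rewrite -ler0c -rnormE. Qed.

Lemma rnorm0 : rnorm (0 : H) = 0.
Proof. by rewrite /rnorm normr0. Qed.

Lemma rnorm0_eq0 x : rnorm x = 0 -> x = 0.
Proof. by move=> x0; apply/normr0_eq0; rewrite rnormE x0. Qed.

Lemma rnormD x y : rnorm (x + y) <= rnorm x + rnorm y.
Proof. by rewrite -lecR rmorphD /= -!rnormE ler_normD. Qed.

Lemma rdistC x y : rnorm (x - y) = rnorm (y - x).
Proof. by rewrite /rnorm distrC. Qed.

Lemma rdist_triangle x y z : rnorm (x - z) <= rnorm (x - y) + rnorm (y - z).
Proof. by apply: le_trans (rnormD _ _); rewrite addrA subrK. Qed.

Lemma rnormZ (a : R[i]) x : rnorm (a *: x) = complex.Re `|a| * rnorm x.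
Proof.
by rewrite /rnorm normrZ [`|x|]rnormE normc_def -rmorphM.
Qed.

Lemma rnormZr r x : 0 <= r -> rnorm (r%:C *: x) = r * rnorm x.
Proof. by move=> r0; rewrite rnormZ ger0_norm// ler0c. Qed.

Lemma rdotDl x y z : rdot (x + y) z = rdot x z + rdot y z.
Proof. by rewrite /rdot linearDl raddfD. Qed.

Lemma rdotC x y : rdot x y = rdot y x.
Proof.
rewrite /rdot (hermC (inner : {dot H for Num.conj}) x) expr0 mul1r /=.
by case: (inner y x).
Qed.

Lemma rdotDr x y z : rdot x (y + z) = rdot x y + rdot x z.
Proof. by rewrite rdotC rdotDl !(rdotC x). Qed.

Lemma rdotZl r x y : rdot (r%:C *: x) y = r * rdot x y.
Proof.
rewrite /rdot linearZl_LR /=.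
by case: (inner x y) => a b /=; rewrite mul0r subr0.
Qed.

Lemma rdotZr r x y : rdot x (r%:C *: y) = r * rdot x y.
Proof. by rewrite rdotC rdotZl rdotC. Qed.

Lemma rdotNl x y : rdot (- x) y = - rdot x y.
Proof. by rewrite /rdot linearNl raddfN. Qed.

Lemma rdotNr x y : rdot x (- y) = - rdot x y.
Proof. by rewrite rdotC rdotNl rdotC. Qed.

Lemma rdotxx x : rdot x x = rnorm x ^+ 2.
Proof. by rewrite /rdot innerE rnormE -rmorphXn. Qed.

Definition rdotE := (rdotDl, rdotDr, rdotNl, rdotNr, rdotZl, rdotZr).

Lemma rnormB_sqr x y :
  rnorm (x - y) ^+ 2 = rnorm x ^+ 2 - 2 * rdot x y + rnorm y ^+ 2.
Proof. by rewrite -!rdotxx !rdotE (rdotC y x); ring. Qed.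

Lemma rnormD_sqr x y :
  rnorm (x + y) ^+ 2 = rnorm x ^+ 2 + 2 * rdot x y + rnorm y ^+ 2.
Proof. by rewrite -!rdotxx !rdotE (rdotC y x); ring. Qed.

(** Cauchy-Schwarz for the real part, read off from the squared triangle inequality. *)
Lemma rdot_le x y : rdot x y <= rnorm x * rnorm y.
Proof.
have := rnormD x y; rewrite -ler_sqr ?nnegrE ?addr_ge0 ?rnorm_ge0//.
rewrite rnormD_sqr sqrrD; lra.
Qed.

(** A positive element of [R[i]] is real, so real tolerances suffice. *)
Lemma cvg_rnormP {T : Type} {F : set_system T} {FF : Filter F} (f : T -> H) (l : H) :
  f x @[x --> F] --> l <->
  (forall e : R, 0 < e -> \forall x \near F, rnorm (l - f x) < e).
Proof.
split=> [/cvgrPdist_lt fl e e0|fl].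
  have := fl e%:C; rewrite ltcR => /(_ e0).
  by apply: filterS => t; rewrite rnormE ltcR.
apply/cvgrPdist_lt => e e0.
have eE : (complex.Re e)%:C = e by rewrite RRe_real// gtr0_real.
have Re0 : 0 < complex.Re e by rewrite -ltcR eE.
apply: filterS (fl _ Re0) => t; rewrite rnormE -{2}eE.
by rewrite ltcR.
Qed.

Lemma rnorm_complete (u : nat -> H) :
  (forall e : R, 0 < e -> exists N, forall m n, (N <= m)%N -> (N <= n)%N ->
     rnorm (u m - u n) < e) -> cvg (u @ \oo).
Proof.
move=> cu; apply: cauchy_cvg; apply: (iffRL (cauchyP _)) => e e0.
have eE : (complex.Re e)%:C = e by rewrite RRe_real// gtr0_real.
have Re0 : 0 < complex.Re e by rewrite -ltcR eE.
have [N uN] := cu _ Re0; exists (u N).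
exists N => // n Nn /=; rewrite -ball_normE /ball_ /= rnormE -eE.
by rewrite ltcR uN.
Qed.

Lemma rnorm_lim_le {T : Type} {F : set_system T} {FF : ProperFilter F} (f : T -> H)
    (l y : H) (M : R) :
  f x @[x --> F] --> l -> (\forall x \near F, rnorm (f x - y) <= M) ->
  rnorm (l - y) <= M.
Proof.
move=> /cvg_rnormP fl fM; apply/ler_addgt0Pr => e e0.
have [t [tl tM]] := filter_ex (filterI (fl e e0) fM).
have := rdist_triangle l (f t) y; lra.
Qed.

End RealStructure.
Arguments rnorm {R H}.
Arguments rdot {R H}.

(** * Convergence of sequences with geometric increments *)

Section Approximation.
Context {R : realType} {H : hilbertType R[i]}.

Lemma rnorm_small_eq0 (x : H) : (forall e : R, 0 < e -> rnorm x <= e) -> x = 0.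
Proof.
move=> xe; apply: rnorm0_eq0; apply/eqP.
rewrite eq_le rnorm_ge0 andbT.
by apply/ler_addgt0Pr => e /xe; rewrite add0r.
Qed.

Lemma geometric_cvg (u : nat -> H) (c q : R) : 0 <= q < 1 ->
  (forall n, rnorm (u n.+1 - u n) <= c * q ^+ n) -> cvg (u @ \oo).
Proof.
move=> /andP[q0 q1] uq.
have q1' : 0 < 1 - q by rewrite subr_gt0.
have c0 : 0 <= c by have := uq 0%N; rewrite expr0 mulr1; apply: le_trans (rnorm_ge0 _).
(* The geometric sum, multiplied through by [1 - q] to avoid division. *)
have tail N k : rnorm (u (N + k)%N - u N) * (1 - q) <= c * q ^+ N * (1 - q ^+ k).
  elim: k => [|k IH]; first by rewrite addn0 subrr rnorm0 mul0r expr0 subrr mulr0.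
  rewrite addnS.
  have H1 := rdist_triangle (u (N + k).+1) (u (N + k)%N) (u N).
  have := uq (N + k)%N; rewrite exprD => H2.
  have H3 : rnorm (u (N + k).+1 - u N) * (1 - q) <=
      c * (q ^+ N * q ^+ k) * (1 - q) + rnorm (u (N + k)%N - u N) * (1 - q).
    by rewrite -mulrDl ler_pM2r//; lra.
  apply: le_trans H3 _; apply: le_trans (lerD (lexx _) IH) _.
  by rewrite exprS; lra.
apply: rnorm_complete => e e0.
have qcvg : (fun n => q ^+ n) @ \oo --> (0 : R).
  by apply: cvg_expr; rewrite ger0_norm.
(* This tolerance on [q ^+ N] brings every tail from [N] below [e / 2]; [c + 1] stands in for [c],
   which may vanish. *)
have d0 : 0 < e * (1 - q) / (2 * (c + 1)).
  by rewrite divr_gt0 ?mulr_gt0// ltr_wpDl.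
have [N _ qN] := (cvgrPdist_lt _ _).1 qcvg _ d0.
have {}qN : c * q ^+ N < e / 2 * (1 - q).
  have := qN N (leqnn N) => /=; rewrite sub0r normrN ger0_norm ?exprn_ge0//.
  rewrite ltr_pdivlMr ?mulr_gt0 ?ltr_wpDl// => qNN.
  have := exprn_ge0 N q0; nra.
have half k : rnorm (u (N + k)%N - u N) < e / 2.
  rewrite -(ltr_pM2r q1'); apply: le_lt_trans (tail N k) _.
  apply: le_lt_trans qN; rewrite ler_piMr ?mulr_ge0 ?exprn_ge0//.
  by rewrite gerBl exprn_ge0.
exists N => m n Nm Nn.
rewrite -(subnKC Nm) -(subnKC Nn).
have := half (m - N)%N; have := half (n - N)%N.
have := rdist_triangle (u (N + (m - N))%N) (u N) (u (N + (n - N))%N).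
rewrite (rdistC (u N)); lra.
Qed.
End Approximation.

(** * Dissipative operators and the range condition in the right half-plane *)

Section Dissipative.
Context {R : realType} {H : hilbertType R[i]} {A : partial_op H H}.
Hypotheses (A_lin : linear_op A) (A_diss : dissipative A).

Lemma linear_opZ (a : R[i]) x : opdom A x -> opdom A (a *: x) /\ A (a *: x) = a *: A x.
Proof.
have [A0 AL] := A_lin.
have A00 : A 0 = 0.
  have [_] := AL 1 0 0 A0 A0; rewrite scaler0 addr0 scale1r.
  by move/esym/eqP; rewrite -subr_eq0 addrK => /eqP.
by move=> Dx; have [] := AL a x 0 Dx A0; rewrite A00 !addr0.
Qed.

Lemma linear_opD x y : opdom A x -> opdom A y ->
  opdom A (x + y) /\ A (x + y) = A x + A y.
Proof. by move=> Dx Dy; have [] := A_lin.2 1 x y Dx Dy; rewrite !scale1r. Qed.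

Lemma linear_opB x y : opdom A x -> opdom A y ->
  opdom A (x - y) /\ A (x - y) = A x - A y.
Proof.
move=> Dx Dy; have [DN AN] := linear_opZ (-1) Dy.
by have [] := linear_opD Dx DN; rewrite AN !scaleN1r.
Qed.

Lemma dissipative_rdot x : opdom A x -> rdot (A x) x <= 0.
Proof. by move=> /A_diss; rewrite -complexRe -lecR. Qed.

(** Pairing [s x - A x] with [x], dissipativity leaves a real part of at least [Re s |x|^2];
    Cauchy-Schwarz then lets one factor [|x|] cancel. *)
Lemma dissipative_bound (s : R[i]) x : opdom A x ->
  complex.Re s * rnorm x <= rnorm (s *: x - A x).
Proof.
move=> Dx; have [->|x0] := eqVneq x 0; first by rewrite rnorm0 mulr0 rnorm_ge0.
have nx : 0 < rnorm x.
  by rewrite lt_def rnorm_ge0 andbT; apply: contra x0 => /eqP/rnorm0_eq0->.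
rewrite -(ler_pM2r nx); apply: le_trans (rdot_le _ _).
rewrite rdotDl rdotNl.
have -> : rdot (s *: x) x = complex.Re s * rnorm x * rnorm x.
  rewrite /rdot linearZl_LR /= innerE rnormE -rmorphXn /=.
  by case: s => a b /=; rewrite mulr0 subr0 expr2 mulrA.
by rewrite lerDl oppr_ge0 dissipative_rdot.
Qed.

(** Only surjectivity is recorded: for linear dissipative [A] and [Re s > 0], injectivity and the
    bound [1 / Re s] on the inverse follow from [dissipative_bound]. *)
Definition resolvent_onto (s : R[i]) :=
  forall f, exists x, opdom A x /\ s *: x - A x = f.

(* Solving [t x - A x = f] is finding a fixed point of the contraction
   [u |-> (s - A)^-1 (f + (s - t) u)]. *)
Lemma resolvent_onto_near (s t : R[i]) : 0 < complex.Re s ->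
  complex.Re `|s - t| < complex.Re s -> resolvent_onto s -> resolvent_onto t.
Proof.
move=> s0 st /choice[S SP] f.
pose G u := S (f + (s - t) *: u); pose u n := iter n G 0.
pose q := complex.Re `|s - t| / complex.Re s.
have q01 : 0 <= q < 1.
  rewrite ltr_pdivrMr// mul1r st andbT divr_ge0 ?(ltW s0)//.
  by rewrite -ler0c RRe_real// normr_real.
have Glip x y : rnorm (G x - G y) <= q * rnorm (x - y).
  rewrite -[q * _]mulrAC ler_pdivlMr// mulrC.
  have [Dx Ex] := SP (f + (s - t) *: x); have [Dy Ey] := SP (f + (s - t) *: y).
  have [Dd Ed] := linear_opB Dx Dy.
  apply: le_trans (dissipative_bound s Dd) _.
  rewrite Ed scalerBr opprD addrACA -opprD Ex Ey.
  by rewrite opprD addrACA subrr add0r -scalerBr rnormZ.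
have /cvg_ex[l /= ul] : cvg (u @ \oo).
  apply: (geometric_cvg (u := u) (c := rnorm (u 1%N - u 0%N)) q01).
  elim=> [|n IH]; first by rewrite expr0 mulr1.
  apply: le_trans (Glip _ _) _; rewrite exprS mulrCA ler_wpM2l//.
  by case/andP: q01.
(* [u N.+1 = G (u N)] is close to [l] and, by [Glip], also to [G l]. *)
have lG : l = G l.
  apply/eqP; rewrite -subr_eq0; apply/eqP/rnorm_small_eq0 => e e0.
  have e20 : 0 < e / 2 by rewrite divr_gt0.
  have [N _ uN] := (cvg_rnormP _ _).1 ul _ e20.
  have := uN N.+1 (leqnSn N); have := uN N (leqnn N) => /= H1 H2.
  have := rdist_triangle l (u N.+1) (G l); have := Glip (u N) l.
  rewrite rdistC in H1; have := rnorm_ge0 (u N - l); case/andP: q01 => ? ?.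
  rewrite -[u N.+1]/(G (u N)) in H2 *; nra.
have [Dl El] := SP (f + (s - t) *: l); exists l.
rewrite {1}lG; split=> //; rewrite -/(G l) -lG in El.
apply: (addIr ((s - t) *: l)); rewrite -El addrAC -scalerDl.
by rewrite [t + _]addrC subrK.
Qed.

(** Walk from [s] to [t] along the segment in [N] equal steps. All its points have real part at
    least [m], and [N] makes each step shorter than [m], so [resolvent_onto_near] applies every
    time. *)
Lemma resolvent_onto_half_plane (s t : R[i]) : 0 < complex.Re s ->
  0 < complex.Re t -> resolvent_onto s -> resolvent_onto t.
Proof.
move=> s0 t0 surj.
pose m := Num.min (complex.Re s) (complex.Re t).
have m0 : 0 < m by rewrite lt_min s0 t0.
have d0 : 0 <= complex.Re `|t - s| / m.
  by rewrite divr_ge0 ?(ltW m0)// -ler0c RRe_real// normr_real.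
pose N := Num.Def.archi_bound (complex.Re `|t - s| / m).
have dN : complex.Re `|t - s| / m < N%:R by apply: archi_boundP.
have N0 : 0 < N%:R :> R by apply: le_lt_trans dN.
pose p k := s + (k%:R / N%:R)%:C * (t - s).
have ReM r (z : R[i]) : complex.Re (r%:C * z) = r * complex.Re z.
  by case: z => a b /=; rewrite mul0r subr0.
have pRe k : (k <= N)%N -> m <= complex.Re (p k).
  move=> kN; rewrite /p raddfD /= ReM raddfB /=.
  have ms : m <= complex.Re s by rewrite ge_min lexx.
  have mt : m <= complex.Re t by rewrite ge_min lexx orbT.
  have k0 : 0 <= k%:R / N%:R :> R by rewrite divr_ge0.
  have k1 : k%:R / N%:R <= 1 :> R by rewrite ler_pdivrMr// mul1r ler_nat.
  nra.
have pN k : (k <= N)%N -> resolvent_onto (p k).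
  elim: k => [_|k IH kN]; first by rewrite /p mul0r mul0r addr0.
  apply: (resolvent_onto_near (s := p k)) (IH (ltnW kN)).
    exact: lt_le_trans m0 (pRe _ (ltnW kN)).
  apply: lt_le_trans (pRe _ (ltnW kN)).
  have -> : p k - p k.+1 = - ((N%:R^-1)%:C * (t - s)).
    rewrite /p -natr1 mulrDl mul1r rmorphD /=; ring.
  rewrite normrN normrM ger0_norm ?ler0c ?invr_ge0 ?ler0n// ReM.
  by rewrite mulrC ltr_pdivrMr// mulrC -ltr_pdivrMr.
have := pN N (leqnn N); rewrite /p divff ?gt_eqF//.
by rewrite mul1r addrC subrK.
Qed.
End Dissipative.

(** * Density of the domain *)

Section Density.
Context {R : realType} {H : hilbertType R[i]} {A : partial_op H H}.
Hypotheses (A_lin : linear_op A) (A_diss : dissipative A).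

(* The foot [u] of the perpendicular from [x] to the closure of the domain
   satisfies [x - u = y - A y] for some [y] in the domain, and testing this
   against [y] forces [y = 0]. *)
Lemma dissipative_dense : resolvent_onto (A := A) 1 ->
  forall x (e : R), 0 < e -> exists y, opdom A y /\ rnorm (x - y) < e.
Proof.
move=> surj x.
pose S := [set rnorm (x - y) ^+ 2 | y in opdom A].
have S_inf : has_inf S.
  split; first by exists (rnorm (x - 0) ^+ 2), 0 => //; exact: A_lin.1.
  by exists 0 => _ [y _ <-]; rewrite exprn_ge0 ?rnorm_ge0.
have [d dE] : {d | d = inf S} by exists (inf S).
have dle y : opdom A y -> d <= rnorm (x - y) ^+ 2.
  by move=> Dy; rewrite dE; apply: ge_inf; [exact: S_inf.2|exists y].
have [i i0 i_small] : exists2 i : nat -> R, forall n, 0 < i n &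
    forall e, 0 < e -> exists N, forall n, (N <= n)%N -> i n < e.
  exists (fun n => n.+1%:R^-1) => [n|e e0]; first by rewrite invr_gt0.
  exists (Num.Def.archi_bound e^-1) => n Nn.
  rewrite invf_plt ?posrE//; apply: lt_le_trans (archi_boundP _) _.
    by rewrite invr_ge0 ltW.
  by rewrite ler_nat ltnW.
have /choice[z zP] n : exists y, opdom A y /\ rnorm (x - y) ^+ 2 < d + i n.
  have [_ [y Dy <-] yd] := inf_adherent (i0 n) S_inf; rewrite -dE in yd.
  by exists y.
have zD n : opdom A (z n) by have [] := zP n.
(* Parallelogram law: the midpoint of [z m] and [z n] lies in the domain, so its squared distance to
   [x] is at least [d]. *)
have zz m n : rnorm (z m - z n) ^+ 2 <= 2 * (i m + i n).
  have [Ds _] := linear_opD A_lin (zD m) (zD n).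
  have [Dh _] := linear_opZ A_lin (2^-1 : R)%:C Ds.
  have := dle _ Dh; have [_ xm] := zP m; have [_ xn] := zP n.
  have : rnorm (x - (2^-1 : R)%:C *: (z m + z n)) ^+ 2 =
    (rnorm (x - z m) ^+ 2 + rnorm (x - z n) ^+ 2) / 2 - rnorm (z m - z n) ^+ 2 / 4.
    by rewrite !rnormB_sqr -![rnorm _ ^+ 2]rdotxx !rdotE (rdotC (z n) (z m)); field.
  lra.
have /cvg_ex[u /= zu] : cvg (z @ \oo).
  apply: rnorm_complete => e e0.
  have [|N Ne] := i_small (e ^+ 2 / 4); first by rewrite divr_gt0 ?exprn_gt0.
  exists N => m n Nm Nn; rewrite -ltr_sqr ?nnegrE ?rnorm_ge0 ?(ltW e0)//.
  have := zz m n; have := Ne m Nm; have := Ne n Nn; lra.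
(* Approximate orthogonality of a near-minimiser: moving [z n] along [y] by the optimal coefficient
   [r / |y|^2] lowers the squared distance by [r^2 / |y|^2], which cannot exceed [i n]. *)
have perp n y : opdom A y -> rdot (x - z n) y ^+ 2 <= rnorm y ^+ 2 * i n.
  move=> Dy; have [y0|y0] := eqVneq y 0.
    rewrite {1}y0 /rdot linear0r expr0n /= mulr_ge0 ?(ltW (i0 n))//.
    by rewrite exprn_ge0 ?rnorm_ge0.
  have ry : 0 < rnorm y.
    rewrite lt_def rnorm_ge0 andbT.
    by apply: contra y0 => /eqP/rnorm0_eq0->.
  have ny : 0 < rnorm y ^+ 2 by rewrite exprn_gt0.
  set r := rdot (x - z n) y.
  have [DZ _] := linear_opZ A_lin (r / rnorm y ^+ 2)%:C Dy.
  have [DD _] := linear_opD A_lin (zD n) DZ.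
  have := dle _ DD; have [_] := zP n.
  rewrite opprD addrA (rnormB_sqr (x - z n)) -[rnorm (_ *: y) ^+ 2]rdotxx !rdotZl.
  rewrite !rdotZr -/r rdotxx => H1 H2.
  have : 2 * (r / rnorm y ^+ 2 * r) - r / rnorm y ^+ 2 * (r / rnorm y ^+ 2 * rnorm y ^+ 2)
     <= i n by lra.
  rewrite [leLHS](_ : _ = r ^+ 2 / rnorm y ^+ 2); last by field; rewrite gt_eqF.
  by rewrite ler_pdivrMr// mulrC.
have [y [Dy Ey]] := surj (x - u); rewrite scale1r in Ey.
(* Dissipativity gives [|y|^2 <= <x - u, y>] (real part), and the right side is 0 by [perp] in the
   limit. *)
have y0 : y = 0.
  apply: rnorm_small_eq0 => e e0.
  have e20 : 0 < e / 2 by rewrite divr_gt0.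
  have [N1 _ N1e] := (cvg_rnormP _ _).1 zu _ e20.
  have [|N2 N2e] := i_small ((e / 2) ^+ 2); first by rewrite exprn_gt0.
  pose n := maxn N1 N2.
  have H1 : rnorm (u - z n) < e / 2 by apply: N1e; exact: leq_maxl.
  have H2 := N2e n (leq_maxr _ _); have H3 := perp n y Dy.
  have [y0|y0] := eqVneq (rnorm y) 0; first by rewrite y0 ltW.
  have ny : 0 < rnorm y by rewrite lt_def y0 rnorm_ge0.
  have H4 : rdot (x - z n) y <= rnorm y * (e / 2).
    rewrite leNgt; apply/negP => H4.
    have p0 : 0 <= rnorm y * (e / 2) by rewrite mulr_ge0 ?rnorm_ge0 ?(ltW e20).
    have := ltW H4; rewrite -ler_sqr ?nnegrE// ?(le_trans p0 (ltW H4))//.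
    have : rnorm y ^+ 2 * i n < rnorm y ^+ 2 * (e / 2) ^+ 2.
      by rewrite ltr_pM2l ?exprn_gt0.
    rewrite exprMn; lra.
  have H5 : rdot (x - u) y <= rdot (x - z n) y + rnorm (u - z n) * rnorm y.
    rewrite rdistC; have := rdot_le (z n - u) y; rewrite !rdotE; lra.
  have H6 := dissipative_rdot A_diss Dy.
  have H7 : rnorm y * rnorm y <= rnorm y * e.
    have : rdot (x - u) y = rnorm y ^+ 2 - rdot (A y) y by rewrite -Ey !rdotE rdotxx.
    nra.
  by rewrite ler_pM2l in H7.
have xu : x = u.
  apply/eqP; rewrite -subr_eq0 -Ey y0.
  by have [_] := linear_opZ A_lin 0 A_lin.1; rewrite !scale0r => ->; rewrite subr0.
move=> e e0; rewrite xu.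
have [N _ Ne] := (cvg_rnormP _ _).1 zu _ e0.
by exists (z N); split; [exact: zD|exact: (Ne N (leqnn N))].
Qed.
End Density.

(** * Iterates of commuting nonexpansive maps *)

Section Iteration.
Context {R : realType} {H : hilbertType R[i]}.
Implicit Types P Q : H -> H.

Definition nonexpansive P := forall x y, rnorm (P x - P y) <= rnorm (x - y).

Lemma iter_nonexpansive P n : nonexpansive P -> nonexpansive (iter n P).
Proof.
by move=> nP x y; elim: n => //= n IH; apply: le_trans (nP _ _) IH.
Qed.

Lemma iter_commute P Q n : (forall x, P (Q x) = Q (P x)) ->
  forall x, iter n P (Q x) = Q (iter n P x).
Proof. by move=> PQ x; elim: n => //= n ->. Qed.

Lemma iter_comp P Q n : (forall x, P (Q x) = Q (P x)) ->
  forall x, iter n (P \o Q) x = iter n P (iter n Q x).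
Proof.
move=> PQ x; elim: n => //= n ->.
by rewrite (iter_commute _ PQ).
Qed.

(** Telescoping: exchange one factor [P] for [Q] at a time. By commutation the exchanged factor can
    act first, on [x], and the remaining nonexpansive factors do not enlarge the defect
    [P x - Q x]. *)
Lemma iter_dist P Q n x : nonexpansive P -> nonexpansive Q ->
  (forall x, P (Q x) = Q (P x)) ->
  rnorm (iter n P x - iter n Q x) <= n%:R * rnorm (P x - Q x).
Proof.
move=> nP nQ PQ; elim: n => [|n IH]; first by rewrite /= subrr rnorm0 mul0r.
apply: le_trans (rdist_triangle _ (iter n P (Q x)) _) _.
rewrite iterSr (iter_commute _ PQ) iterS -natr1 mulrDl mul1r addrC.
apply: lerD; first exact: le_trans (nQ _ _) IH.
by rewrite -(iter_commute _ PQ); apply: iter_nonexpansive.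
Qed.

Lemma pow2_small (c e : R) : 0 < e -> exists N, forall n, (N <= n)%N -> c / 2 ^+ n < e.
Proof.
move=> e0; have c0 : 0 < `|c| + 1 by rewrite ltr_wpDl.
have qcvg : (fun n => 2^-1 ^+ n) @ \oo --> (0 : R).
  by apply: cvg_expr; rewrite ger0_norm; lra.
have [N _ qN] := (cvgrPdist_lt _ _).1 qcvg _ (divr_gt0 e0 c0).
exists N => n Nn; have := qN n Nn.
rewrite /= sub0r normrN exprVn ger0_norm ?invr_ge0 ?exprn_ge0//.
rewrite ltr_pdivlMr// mulrC; apply: le_lt_trans.
rewrite ler_wpM2r ?invr_ge0 ?exprn_ge0//.
by rewrite (le_trans (ler_norm c))// lerDl.
Qed.
End Iteration.

(** * The resolvents [(1 - h A)^-1] and their calculus *)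

Section Resolvent.
Context {R : realType} {H : hilbertType R[i]} {A : partial_op H H}.
Hypotheses (A_lin : linear_op A) (A_diss : dissipative A).
Hypothesis A_onto : forall r : R, 0 < r -> resolvent_onto (A := A) r%:C.
Implicit Types (h : R) (x y : H).

(* The default value makes [resolvent 0] the identity. *)
Definition resolvent h x : H :=
  xget x [set u | opdom A u /\ u - h%:C *: A u = x].
Local Notation J := resolvent.

Lemma resolvent0 x : J 0 x = x.
Proof. by rewrite /J; case: xgetP => //= u _ [_]; rewrite scale0r subr0. Qed.

Lemma resolventP h x : 0 < h -> opdom A (J h x) /\ J h x - h%:C *: A (J h x) = x.
Proof.
move=> h0; rewrite /J; case: xgetP => [u _ //|/(_ _)/= none].
have hV : 0 < h^-1 by rewrite invr_gt0.
have [u [Du Eu]] := A_onto hV ((h^-1)%:C *: x).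
case: (none u); split=> //; have := congr1 (GRing.scale h%:C) Eu.
by rewrite scalerBr !scalerA -rmorphM divff ?gt_eqF// !scale1r.
Qed.

Lemma resolvent_le h u : 0 <= h -> opdom A u -> rnorm u <= rnorm (u - h%:C *: A u).
Proof.
rewrite le_eqVlt => /predU1P[<-|h0] Du; first by rewrite scale0r subr0.
have [-> //|u0] := eqVneq u 0; first by rewrite rnorm0 rnorm_ge0.
have nu : 0 < rnorm u.
  by rewrite lt_def rnorm_ge0 andbT; apply: contra u0 => /eqP/rnorm0_eq0->.
rewrite -(ler_pM2r nu); apply: le_trans (rdot_le _ _).
rewrite !rdotE rdotxx -expr2 lerDl oppr_ge0.
exact: mulr_ge0_le0 (ltW h0) (dissipative_rdot A_diss Du).
Qed.

(** [resolvent_le] makes [1 - h A] injective. Linearity of [J] and its commutation rules are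
    obtained by exhibiting a solution and invoking this. *)
Lemma resolvent_uniq h u x : 0 <= h -> opdom A u -> u - h%:C *: A u = x -> J h x = u.
Proof.
rewrite le_eqVlt => /predU1P[<- _|h0 Du Eu].
  by rewrite scale0r subr0 resolvent0.
have [Dv Ev] := resolventP x h0.
have [Dd Ed] := linear_opB A_lin Dv Du.
apply/eqP; rewrite -subr_eq0; apply/eqP/rnorm0_eq0/le_anti.
rewrite rnorm_ge0 andbT; apply: le_trans (resolvent_le (ltW h0) Dd) _.
by rewrite Ed scalerBr opprD addrACA -opprD Ev Eu subrr rnorm0.
Qed.

(** At [h = 0] the resolvent is the identity and gains no regularity, so [x] is taken in the domain
    to cover both cases at once. *)
Lemma resolvent_domP h x : 0 <= h -> opdom A x ->
  opdom A (J h x) /\ J h x - h%:C *: A (J h x) = x.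
Proof.
rewrite le_eqVlt => /predU1P[<- Dx|h0 _]; last exact: resolventP.
by rewrite resolvent0 scale0r subr0.
Qed.

Lemma resolvent_linear h a x y : 0 <= h -> J h (a *: x + y) = a *: J h x + J h y.
Proof.
rewrite le_eqVlt => /predU1P[<-|h0]; first by rewrite !resolvent0.
have [Du Eu] := resolventP x h0; have [Dv Ev] := resolventP y h0.
have [Dw Ew] := A_lin.2 a _ _ Du Dv.
apply: (resolvent_uniq (ltW h0) Dw).
rewrite Ew -[in RHS]Eu -[in RHS]Ev !scalerBr scalerDr !scalerA opprD addrACA.
by rewrite [_ * a]mulrC.
Qed.

Lemma resolventD h x y : 0 <= h -> J h (x + y) = J h x + J h y.
Proof. by move=> h0; rewrite -{1}[x]scale1r resolvent_linear// scale1r. Qed.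

Lemma resolvent_0 h : 0 <= h -> J h 0 = 0.
Proof.
move=> h0; have := resolventD 0 0 h0; rewrite addr0 => /esym/eqP.
by rewrite -subr_eq0 addrK => /eqP.
Qed.

Lemma resolventZ h a x : 0 <= h -> J h (a *: x) = a *: J h x.
Proof. by move=> h0; rewrite -[a *: x]addr0 resolvent_linear// resolvent_0 ?addr0. Qed.

Lemma resolventB h x y : 0 <= h -> J h (x - y) = J h x - J h y.
Proof. by move=> h0; rewrite -!(scaleN1r y) -!(scaleN1r (J h y)) resolventD// resolventZ. Qed.

Lemma resolvent_contraction h x : 0 <= h -> rnorm (J h x) <= rnorm x.
Proof.
rewrite le_eqVlt => /predU1P[<-|h0]; first by rewrite resolvent0.
have [Du Eu] := resolventP x h0.
by rewrite -{2}Eu; apply: resolvent_le (ltW h0) Du.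
Qed.

Lemma resolvent_nonexpansive h : 0 <= h -> nonexpansive (J h).
Proof. by move=> h0 x y; rewrite -resolventB// resolvent_contraction. Qed.

(** For [h > 0], the vector [A (J h x) = (J h x - x) / h] lies in the domain along with [x], and
    [1 - h A] sends it to [A x]. *)
Lemma resolvent_A h x : 0 <= h -> opdom A x -> A (J h x) = J h (A x).
Proof.
rewrite le_eqVlt => /predU1P[<-|h0 Dx]; first by rewrite !resolvent0.
have [Du Eu] := resolventP x h0.
have hu : A (J h x) = (h^-1)%:C *: (J h x - x).
  by rewrite -{3}Eu subKr scalerA -rmorphM mulVf ?gt_eqF// scale1r.
have [Dd Ed] := linear_opB A_lin Du Dx.
have [DA EA] := linear_opZ A_lin (h^-1)%:C Dd; rewrite -hu in DA EA.
apply/esym/(resolvent_uniq (ltW h0)) => //.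
rewrite EA Ed scalerA -rmorphM divff ?gt_eqF// scale1r.
by rewrite opprB addrC subrK.
Qed.

(** Since [J b] commutes with [A] on the domain, [1 - a A] sends [J b (J a x)] to [J b x]. *)
Lemma resolvent_C a b x : 0 <= a -> 0 <= b -> J a (J b x) = J b (J a x).
Proof.
move=> + b0; rewrite le_eqVlt => /predU1P[<-|a0]; first by rewrite !resolvent0.
have [Dv Ev] := resolventP x a0; have [Dw _] := resolvent_domP b0 Dv.
apply: (resolvent_uniq (ltW a0) Dw).
by rewrite resolvent_A// -resolventZ// -resolventB// Ev.
Qed.

Lemma resolvent_sub h x : 0 <= h -> opdom A x -> J h x - x = h%:C *: J h (A x).
Proof.
move=> h0 Dx; have [_ {2}<-] := resolvent_domP h0 Dx.
by rewrite subKr resolvent_A.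
Qed.

Lemma resolvent_dist h x : 0 <= h -> opdom A x -> rnorm (J h x - x) <= h * rnorm (A x).
Proof.
move=> h0 Dx; rewrite resolvent_sub// rnormZr//.
by rewrite ler_wpM2l// resolvent_contraction.
Qed.

(* [(1 - aA)(1 - bA) = 1 - (a + b)A + abA^2] *)
Lemma resolvent_comp_dist a b x : 0 <= a -> 0 <= b -> opdom A x -> opdom A (A x) ->
  rnorm (J (a + b) x - J a (J b x)) <= a * b * rnorm (A (A x)).
Proof.
move=> a0 b0 Dx DAx; set y := J a (J b x).
have [Du Eu] := resolvent_domP b0 Dx; have [Dy Ey] := resolvent_domP a0 Du.
rewrite -/y in Dy Ey.
have [DAu _] := resolvent_domP b0 DAx; rewrite -resolvent_A// in DAu.
have [DAy _] := resolvent_domP a0 DAu; rewrite -resolvent_A// -/y in DAy.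
have AAy : A (A y) = J a (J b (A (A x))).
  by rewrite /y (resolvent_A a0 Du) (resolvent_A a0 DAu) (resolvent_A b0 Dx) (resolvent_A b0 DAx).
(* By uniqueness [y = J (a + b) (x - a b A^2 y)], so the difference to be bounded is
   [a b J (a + b) (A^2 y)]. *)
have Ex : y - (a + b)%:C *: A y = x - (a * b)%:C *: A (A y).
  have [DaA EaA] := linear_opZ A_lin a%:C DAy.
  have [_ EA] := linear_opB A_lin Dy DaA; rewrite Ey EaA in EA.
  rewrite -Eu EA -Ey scalerBr scalerA -rmorphM (mulrC b) rmorphD scalerDl.
  by rewrite opprB addrA [RHS]addrAC addrK opprD addrA.
have ab0 := addr_ge0 a0 b0.
rewrite -(resolvent_uniq ab0 Dy Ex) -resolventB// subKr resolventZ//.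
rewrite rnormZr ?mulr_ge0// ler_wpM2l ?mulr_ge0//.
by rewrite AAy !(le_trans (resolvent_contraction _ _)).
Qed.

Lemma resolvent_iter_dist h k x : 0 <= h -> opdom A x ->
  rnorm (iter k (J h) x - x) <= k%:R * h * rnorm (A x).
Proof.
move=> h0 Dx.
have := @iter_dist R H (J h) id k x (resolvent_nonexpansive h0).
have -> : iter k id x = x by elim: k => //= k ->.
move=> /(_ (fun _ _ => lexx _) (fun=> erefl)) /le_trans; apply.
by rewrite -mulrA ler_wpM2l// resolvent_dist.
Qed.

Lemma resolvent_iterZ h k a x : 0 <= h ->
  iter k (J h) (a *: x) = a *: iter k (J h) x.
Proof. by move=> h0; elim: k => //= k ->; rewrite resolventZ. Qed.

Lemma resolvent_iterD h k x y : 0 <= h ->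
  iter k (J h) (x + y) = iter k (J h) x + iter k (J h) y.
Proof. by move=> h0; elim: k => //= k ->; rewrite resolventD. Qed.

(** The error depends on [n] and [h] only through the total time [n h], so the expansion survives
    the limit of the Euler scheme. As [A x] may lie outside the domain, a point [y] of the domain
    approximates it. *)
Lemma resolvent_iter_taylor h n x y : 0 <= h -> opdom A x -> opdom A y ->
  rnorm (iter n (J h) x - (x + (n%:R * h)%:C *: A x)) <=
    n%:R * h * (2 * rnorm (A x - y) + n%:R * h * rnorm (A y)).
Proof.
move=> h0 Dx Dy; set c := 2 * _ + _.
have cP k : (k <= n)%N -> rnorm (iter k (J h) (A x) - A x) <= c.
  move=> kn.
  have H1 := rdist_triangle (iter k (J h) (A x)) (iter k (J h) y) (A x).
  have H2 := rdist_triangle (iter k (J h) y) y (A x).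
  have H3 := iter_nonexpansive k (resolvent_nonexpansive h0) (A x) y.
  have H4 := resolvent_iter_dist k h0 Dy.
  have H5 : k%:R * h * rnorm (A y) <= n%:R * h * rnorm (A y).
    by rewrite -!mulrA ler_wpM2r ?ler_nat// mulr_ge0 ?rnorm_ge0.
  rewrite [rnorm (y - _)]rdistC in H2; rewrite /c; lra.
suff S k : (k <= n)%N ->
    rnorm (iter k (J h) x - (x + (k%:R * h)%:C *: A x)) <= k%:R * h * c by exact: S.
elim: k => [|k IH] kn.
  by rewrite /= !mul0r scale0r addr0 subrr rnorm0.
(* Because [J h x - x = h J h (A x)], one more step adds [h] times the [k.+1]-st iterate at [A x];
   compared with [h A x] this costs at most [h c]. *)
have -> : iter k.+1 (J h) x - (x + (k.+1%:R * h)%:C *: A x) =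
    (iter k (J h) x - (x + (k%:R * h)%:C *: A x)) +
    h%:C *: (iter k.+1 (J h) (A x) - A x).
  have -> : iter k.+1 (J h) x = iter k (J h) x + h%:C *: iter k.+1 (J h) (A x).
    rewrite iterSr -{1}[J h x](subrK x) resolvent_iterD// resolvent_sub//.
    by rewrite resolvent_iterZ// -iterSr addrC.
  rewrite scalerBr -natr1 mulrDl mul1r rmorphD scalerDl [x + (_ + _)]addrA opprD.
  by rewrite addrACA.
apply: le_trans (rnormD _ _) _.
rewrite rnormZr// -natr1 !mulrDl mul1r lerD ?IH ?(ltnW kn)//.
by rewrite ler_wpM2l// cP.
Qed.

End Resolvent.

(** * Convergence of the Euler scheme and the semigroup it generates *)

Section Generation.
Context {R : realType} {H : hilbertType R[i]} {A : partial_op H H}.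
Hypotheses (A_lin : linear_op A) (A_diss : dissipative A).
Hypothesis A_onto : forall r : R, 0 < r -> resolvent_onto (A := A) r%:C.
Implicit Types (s t : R) (x y : H).
Local Notation J := (resolvent (A := A)).

(** With dyadic step counts, passing from [n] to [n.+1] halves each step: [J (h + h)] is replaced by
    [J h \o J h]. *)
Definition euler (n : nat) t x : H := iter (2 ^ n) (J (t / 2 ^+ n)) x.

(** [J h] maps the domain of [A] into that of [A^2] and moves a point [z] of the domain by at most
    [h |A z|]. *)
Lemma dissipative_dense2 x (e : R) : 0 < e ->
  exists y, [/\ opdom A y, opdom A (A y) & rnorm (x - y) < e].
Proof.
move=> e0; have e20 : 0 < e / 2 by rewrite divr_gt0.
have [z [Dz xz]] := dissipative_dense A_lin A_diss (A_onto ltr01) x e20.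
pose h := e / 2 / (rnorm (A z) + 1).
have c0 : 0 < rnorm (A z) + 1 by rewrite ltr_wpDl ?rnorm_ge0.
have h0 : 0 < h by rewrite divr_gt0.
have [Dy Ey] := resolventP A_onto z h0; exists (J h z).
have DAy : opdom A (A (J h z)).
  have -> : A (J h z) = (h^-1)%:C *: (J h z - z).
    by rewrite -{3}Ey subKr scalerA -rmorphM mulVf ?gt_eqF// scale1r.
  by have [Dd _] := linear_opB A_lin Dy Dz; have [] := linear_opZ A_lin (h^-1)%:C Dd.
split=> //.
have := rdist_triangle x z (J h z).
have := resolvent_dist A_lin A_diss A_onto (ltW h0) Dz; rewrite rdistC.
have : h * rnorm (A z) <= e / 2.
  by rewrite /h mulrAC ler_pdivrMr// ler_wpM2l ?(ltW e20)// lerDl.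
lra.
Qed.

Lemma scaled_ge0 t n : 0 <= t -> 0 <= t / 2 ^+ n.
Proof. by move=> t0; rewrite divr_ge0 ?exprn_ge0. Qed.

Lemma euler_nonexpansive n t : 0 <= t -> nonexpansive (euler n t).
Proof.
move=> t0; apply/iter_nonexpansive/resolvent_nonexpansive => //.
exact: scaled_ge0.
Qed.

Lemma pow2E n : (2 ^ n)%:R = 2 ^+ n :> R.
Proof. by rewrite natrX. Qed.

Lemma pow2_neq0 n : 2 ^+ n != 0 :> R.
Proof. by rewrite expf_neq0// pnatr_eq0. Qed.

(** With [h = t / 2^(n+1)], each of the [2^n] replacements of [J (h + h)] by [J h \o J h] costs at
    most [h^2 |A^2 x|], and [2^n h^2 = (t^2 / 4) / 2^n]. *)
Lemma euler_step n t x : 0 <= t -> opdom A x -> opdom A (A x) ->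
  rnorm (euler n.+1 t x - euler n t x) <= t ^+ 2 / 4 * rnorm (A (A x)) * 2^-1 ^+ n.
Proof.
move=> t0 Dx DAx; rewrite rdistC.
have h0 := scaled_ge0 n.+1 t0; set h := t / 2 ^+ n.+1 in h0.
have hh : t / 2 ^+ n = h + h by rewrite /h exprS; field; exact: pow2_neq0.
have -> : euler n.+1 t x = iter (2 ^ n) (J h \o J h) x.
  by rewrite /euler -/h expnS mulnC iterM.
have n2 : nonexpansive (J h \o J h).
  move=> y z; apply: le_trans (resolvent_nonexpansive _ _ _ h0 _ _) _ => //.
  exact: resolvent_nonexpansive.
have h20 : 0 <= h + h by rewrite addr_ge0.
rewrite /euler hh.
have nh := resolvent_nonexpansive A_lin A_diss A_onto h20.
apply: le_trans (iter_dist _ _ nh n2 _) _.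
  by move=> y /=; rewrite !(resolvent_C _ _ _ _ h20).
have := resolvent_comp_dist A_lin A_diss A_onto h0 h0 Dx DAx.
rewrite -(ler_pM2l (_ : 0 < (2 ^ n)%:R)) ?ltr0n ?expn_gt0// => /le_trans; apply.
rewrite pow2E exprVn le_eqVlt; apply/orP; left; apply/eqP.
by rewrite /h exprS; field; exact: pow2_neq0.
Qed.

(** Geometric increments settle the domain of [A^2]; density and nonexpansiveness uniform in [n]
    extend convergence to the whole space. *)
Lemma euler_cvg t x : 0 <= t -> cvg (euler n t x @[n --> \oo]).
Proof.
move=> t0.
have cvg2 y : opdom A y -> opdom A (A y) -> cvg (euler n t y @[n --> \oo]).
  move=> Dy DAy; apply: (geometric_cvg (u := fun n => euler n t y) (q := 2^-1)).
    by apply/andP; split; lra.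
  by move=> n; apply: euler_step.
apply: (rnorm_complete (u := fun n => euler n t x)) => e e0.
have e40 : 0 < e / 4 by rewrite divr_gt0.
have [y [Dy DAy xy]] := dissipative_dense2 x e40.
have /cvg_ex[l /= yl] := cvg2 y Dy DAy.
have [N _ Nl] := (cvg_rnormP _ _).1 yl _ e40.
exists N => m n Nm Nn.
have := Nl m Nm; have := Nl n Nn => /= H1 H2.
have H3 := euler_nonexpansive m t0 x y; have H4 := euler_nonexpansive n t0 x y.
have H5 := rdist_triangle (euler m t x) (euler m t y) (euler n t x).
have H6 := rdist_triangle (euler m t y) l (euler n t x).
have H7 := rdist_triangle l (euler n t y) (euler n t x).
rewrite rdistC in H2; rewrite rdistC in H4; lra.
Qed.

(** Times are clipped at 0 so that the limit is linear for every real [t], as the type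
    [R -> {linear X -> X}] of a semigroup demands. *)
Definition euler_lim t x : H := lim (euler n (Num.max 0 t) x @[n --> \oo]).

Lemma euler_limP t x : 0 <= t -> euler n t x @[n --> \oo] --> euler_lim t x.
Proof. by move=> t0; rewrite /euler_lim max_r//; apply: euler_cvg. Qed.

Lemma euler_lim_near t x (e : R) : 0 <= t -> 0 < e ->
  exists N, forall n, (N <= n)%N -> rnorm (euler_lim t x - euler n t x) < e.
Proof.
by move=> t0 e0; have [N _ ?] := (cvg_rnormP _ _).1 (euler_limP (x := x) t0) _ e0; exists N.
Qed.

Lemma euler_lim_linear t : linear (euler_lim t).
Proof.
move=> a x y; rewrite /euler_lim; set r := Num.max 0 t.
have r0 : 0 <= r by rewrite le_max lexx.
apply/cvg_lim => //.
rewrite [X in X @ _](_ : _ = fun n => a *: euler n r x + euler n r y).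
  by apply: cvgD; [apply: cvgZr|]; exact: euler_cvg.
apply/funext => n; rewrite /euler resolvent_iterD ?scaled_ge0//.
by rewrite resolvent_iterZ ?scaled_ge0.
Qed.

Lemma euler_lim_nonexpansive t : 0 <= t -> nonexpansive (euler_lim t).
Proof.
move=> t0 x y; apply/ler_addgt0Pr => e e0.
have e20 : 0 < e / 2 by rewrite divr_gt0.
have [N Nx] := euler_lim_near x t0 e20; have [M My] := euler_lim_near y t0 e20.
have := Nx _ (leq_maxl N M); have := My _ (leq_maxr N M); set n := maxn N M.
move=> H1 H2; have H3 := euler_nonexpansive n t0 x y.
have H4 := rdist_triangle (euler_lim t x) (euler n t x) (euler_lim t y).
have H5 := rdist_triangle (euler n t x) (euler n t y) (euler_lim t y).
rewrite rdistC in H1; lra.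
Qed.

Lemma euler_lim_linear0 t : euler_lim t 0 = 0.
Proof.
have := euler_lim_linear t (-1) 0 0; rewrite scaler0 addr0 => ->.
by rewrite scaleN1r addNr.
Qed.

Lemma euler_lim_contraction t x : 0 <= t -> rnorm (euler_lim t x) <= rnorm x.
Proof.
move=> t0; have := euler_lim_nonexpansive t0 x 0.
by rewrite euler_lim_linear0 !subr0.
Qed.

Lemma euler_lim0 x : euler_lim 0 x = x.
Proof.
rewrite /euler_lim maxxx; apply/cvg_lim => //.
rewrite [X in X @ _](_ : _ = fun=> x); first exact: cvg_cst.
apply/funext => n; rewrite /euler mul0r.
by elim: (2 ^ n)%N => //= k ->; rewrite resolvent0.
Qed.

(** Each of the [2^n] steps costs at most [(s / 2^n) (t / 2^n) |A^2 x|]. *)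
Lemma eulerD n s t x : 0 <= s -> 0 <= t -> opdom A x -> opdom A (A x) ->
  rnorm (euler n (s + t) x - euler n s (euler n t x)) <=
    s * t * rnorm (A (A x)) / 2 ^+ n.
Proof.
move=> s0 t0 Dx DAx; rewrite /euler mulrDl.
have a0 := scaled_ge0 n s0; have b0 := scaled_ge0 n t0.
set a := s / _ in a0 *; set b := t / _ in b0 *.
have ab0 := addr_ge0 a0 b0.
have JC := resolvent_C A_lin A_diss A_onto.
rewrite -(iter_comp _ (fun y => JC a b y a0 b0)).
have nab : nonexpansive (J a \o J b).
  move=> y z; apply: le_trans (resolvent_nonexpansive _ _ _ a0 _ _) _ => //.
  exact: resolvent_nonexpansive.
apply: le_trans (iter_dist _ _ (resolvent_nonexpansive A_lin A_diss A_onto ab0) nab _) _.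
  by move=> y /=; rewrite (JC _ a)// (JC _ b).
have := resolvent_comp_dist A_lin A_diss A_onto a0 b0 Dx DAx.
rewrite -(ler_pM2l (_ : 0 < (2 ^ n)%:R)) ?ltr0n ?expn_gt0// => /le_trans; apply.
rewrite pow2E le_eqVlt; apply/orP; left; apply/eqP.
by rewrite /a /b; field; exact: pow2_neq0.
Qed.

(** Replace [x] by a nearby [y] in the domain of [A^2], where [eulerD] applies. Of the six errors of
    size [e / 6], two come from this replacement, three from exchanging limits with approximations,
    one from [eulerD]. *)
Lemma euler_limD s t x : 0 <= s -> 0 <= t ->
  euler_lim (s + t) x = euler_lim s (euler_lim t x).
Proof.
move=> s0 t0; have st0 := addr_ge0 s0 t0.
apply/eqP; rewrite -subr_eq0; apply/eqP/rnorm_small_eq0 => e e0.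
have e60 : 0 < e / 6 by rewrite divr_gt0.
have [y [Dy DAy xy]] := dissipative_dense2 x e60.
have [N1 H1] := euler_lim_near y st0 e60.
have [N2 H2] := pow2_small (s * t * rnorm (A (A y))) e60.
have [N3 H3] := euler_lim_near y t0 e60.
have [N4 H4] := euler_lim_near (euler_lim t y) s0 e60.
pose n := maxn (maxn N1 N2) (maxn N3 N4).
have {}H1 := H1 n ltac:(by rewrite !leq_max leqnn).
have {}H2 := H2 n ltac:(by rewrite !leq_max leqnn ?orbT).
have {}H3 := H3 n ltac:(by rewrite !leq_max leqnn ?orbT).
have {}H4 := H4 n ltac:(by rewrite !leq_max leqnn ?orbT).
have D1 : rnorm (euler_lim (s + t) x - euler_lim (s + t) y) < e / 6.
  exact: le_lt_trans (euler_lim_nonexpansive st0 x y) xy.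
have D2 : rnorm (euler n (s + t) y - euler n s (euler n t y)) < e / 6.
  exact: le_lt_trans (eulerD n s0 t0 Dy DAy) H2.
have D3 : rnorm (euler n s (euler n t y) - euler n s (euler_lim t y)) < e / 6.
  by apply: le_lt_trans (euler_nonexpansive _ s0 _ _) _; rewrite rdistC.
have D4 : rnorm (euler_lim s (euler_lim t y) - euler_lim s (euler_lim t x)) < e / 6.
  apply: le_lt_trans (euler_lim_nonexpansive s0 _ _) _.
  by apply: le_lt_trans (euler_lim_nonexpansive t0 _ _) _; rewrite rdistC.
rewrite rdistC in H4.
apply: le_trans (rdist_triangle _ (euler_lim (s + t) y) _) _.
rewrite [e in _ <= e](_ : _ = e / 6 + (e / 6 + (e / 6 + (e / 6 + (e / 6 + e / 6))))); last by field.
apply: lerD (ltW D1) _; apply: le_trans (rdist_triangle _ (euler n (s + t) y) _) _.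
apply: lerD (ltW H1) _; apply: le_trans (rdist_triangle _ (euler n s (euler n t y)) _) _.
apply: lerD (ltW D2) _; apply: le_trans (rdist_triangle _ (euler n s (euler_lim t y)) _) _.
apply: lerD (ltW D3) _; apply: le_trans (rdist_triangle _ (euler_lim s (euler_lim t y)) _) _.
exact: lerD (ltW H4) (ltW D4).
Qed.

Lemma euler_lim_taylor t x y : 0 <= t -> opdom A x -> opdom A y ->
  rnorm (euler_lim t x - (x + t%:C *: A x)) <=
    t * (2 * rnorm (A x - y) + t * rnorm (A y)).
Proof.
move=> t0 Dx Dy; apply: (rnorm_lim_le (euler_limP (x := x) t0)).
apply: nearW => n; rewrite /euler.
have := resolvent_iter_taylor A_lin A_diss A_onto (2 ^ n) (scaled_ge0 n t0) Dx Dy.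
by rewrite pow2E (mulrC (2 ^+ n)) divfK ?pow2_neq0.
Qed.

Lemma euler_lim_dist t x : 0 <= t -> opdom A x ->
  rnorm (euler_lim t x - x) <= t * rnorm (A x).
Proof.
move=> t0 Dx; apply: (rnorm_lim_le (euler_limP (x := x) t0)).
apply: nearW => n; rewrite /euler.
have := resolvent_iter_dist A_lin A_diss A_onto (2 ^ n) (scaled_ge0 n t0) Dx.
by rewrite pow2E (mulrC (2 ^+ n)) divfK ?pow2_neq0.
Qed.

Lemma euler_lim_strong_cvg x : euler_lim t x @[t --> (0 : R)^'+] --> x.
Proof.
apply/cvg_rnormP => e e0; have e40 : 0 < e / 4 by rewrite divr_gt0.
have [y [Dy xy]] := dissipative_dense A_lin A_diss (A_onto ltr01) x e40.
have c0 : 0 < rnorm (A y) + 1 by rewrite ltr_wpDl ?rnorm_ge0.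
near=> t.
have t0 : 0 <= t by apply: ltW; near: t; exact: nbhs_right_gt.
have te : t < e / 4 / (rnorm (A y) + 1).
  by near: t; apply: nbhs_right_lt; rewrite divr_gt0.
rewrite ltr_pdivlMr// mulrDr mulr1 in te.
have H1 := euler_lim_nonexpansive t0 x y; have H2 := euler_lim_dist t0 Dy.
have H3 := rdist_triangle x y (euler_lim t x).
have H4 := rdist_triangle y (euler_lim t y) (euler_lim t x).
rewrite rdistC in H1; rewrite rdistC in H2; lra.
Unshelve. all: by end_near. Qed.

(** Divided by [t], the expansion error is [2 |A x - y| + t |A y|]: the first term is small by the
    choice of [y] near [A x], the second as [t] tends to 0. *)
Lemma euler_lim_derivative x : opdom A x ->
  (t^-1)%:C *: (euler_lim t x - x) @[t --> (0 : R)^'+] --> A x.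
Proof.
move=> Dx; apply/cvg_rnormP => e e0; have e40 : 0 < e / 4 by rewrite divr_gt0.
have [y [Dy xy]] := dissipative_dense A_lin A_diss (A_onto ltr01) (A x) e40.
have c0 : 0 < rnorm (A y) + 1 by rewrite ltr_wpDl ?rnorm_ge0.
near=> t.
have t0 : 0 < t by near: t; exact: nbhs_right_gt.
have te : t < e / 4 / (rnorm (A y) + 1).
  by near: t; apply: nbhs_right_lt; rewrite divr_gt0.
rewrite ltr_pdivlMr// mulrDr mulr1 in te.
rewrite rdistC -(ltr_pM2l t0) -rnormZr ?(ltW t0)//.
rewrite scalerBr scalerA -rmorphM divff ?gt_eqF// scale1r -addrA -opprD.
apply: le_lt_trans (euler_lim_taylor (ltW t0) Dx Dy) _.
by rewrite ltr_pM2l//; lra.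
Unshelve. all: by end_near. Qed.

Theorem lumer_phillips : generates_contraction_semigroup A.
Proof.
have /choice[T TE] t : exists f : {linear H -> H}, f =1 euler_lim t.
  pose f : {linear H -> H} :=
    HB.pack (euler_lim t) (GRing.isLinear.Build _ _ _ _ (euler_lim t) (euler_lim_linear t)).
  by exists f.
have TA x : opdom A x -> difference_quotient T x t @[t --> (0 : R)^'+] --> A x.
  move=> Dx; rewrite /difference_quotient.
  by under eq_fun do rewrite TE; exact: euler_lim_derivative.
have TcA x : opdom A x -> opdom (generator T) x /\ generator T x = A x.
  move=> /TA xA; split; first by apply/cvg_ex; exists (A x).
  exact/cvg_lim.
have TB x y t : difference_quotient T (x - y) t =
    difference_quotient T x t - difference_quotient T y t.
  by rewrite /difference_quotient (linearB (T t)) -scalerBr opprD addrACA -opprD.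
exists T; split.
- split.
  + by move=> x; rewrite TE euler_lim0.
  + by move=> s t s0 t0 x; rewrite !TE euler_limD.
  + move=> t t0 x; rewrite !rnormE lecR TE; exact: euler_lim_contraction.
  + by move=> x; under eq_fun do rewrite TE; exact: euler_lim_strong_cvg.
- apply/seteqP; split=> [x /TcA[] //|x /cvg_ex[z /= xz]].
  (* The generator has no larger domain: [u] solves [u - A u = x - z], so the difference quotients
     of [d = x - u] tend to [d] itself. Contractivity makes their real inner product with [d]
     nonpositive, whence [|d|^2 <= 0]. *)
  have [u [Du Eu]] := A_onto ltr01 (x - z); rewrite scale1r in Eu.
  suff -> : x = u by [].
  have dz : difference_quotient T (x - u) t @[t --> (0 : R)^'+] --> x - u.
    have xuE : x - u = z - A u.
      by apply/eqP; rewrite -subr_eq0 opprD addrACA -opprD Eu subrr.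
    rewrite {2}xuE (funext (TB x u)); apply: cvgB; first exact: xz.
    exact: TA.
  apply/eqP; rewrite -subr_eq0; apply/eqP.
  move: dz; set d := x - u => dz.
  apply: rnorm_small_eq0 => e e0.
  have dze : \forall t \near (0 : R)^'+, rnorm (d - difference_quotient T d t) < e.
    by move/cvg_rnormP: dz; apply.
  have F0 : ProperFilter (nbhs (0 : R)^'+) by exact: at_right_proper_filter.
  have [t [td t0]] := filter_ex (filterI dze (nbhs_right_gt (0 : R))).
  have tV : 0 < t^-1 by rewrite invr_gt0.
  have H1 : rdot (difference_quotient T d t) d <= 0.
    rewrite /difference_quotient rdotZl rdotDl rdotNl rdotxx TE.
    rewrite pmulr_rle0// subr_le0; apply: le_trans (rdot_le _ _) _.
    by rewrite expr2 ler_wpM2r ?rnorm_ge0// euler_lim_contraction// ltW.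
  have [d0|d0] := eqVneq (rnorm d) 0; first by rewrite d0 ltW.
  have nd : 0 < rnorm d by rewrite lt_def d0 rnorm_ge0.
  have H2 := rdot_le (d - difference_quotient T d t) d.
  rewrite rdotDl rdotNl rdotxx in H2; rewrite -(ler_pM2r nd).
  have H3 : rnorm (d - difference_quotient T d t) * rnorm d <= e * rnorm d.
    by rewrite ler_pM2r// ltW.
  lra.
- by move=> x /TcA[_ ->].
Qed.
End Generation.

(** * Inverses and adjoints of the coefficient operators *)

Section Reduction.
Context {C : numClosedFieldType}.

Lemma inv_opK {X : hilbertType C} (f : X -> X) :
  boundedly_invertible (total_op f) -> cancel f (inv_op (total_op f)).
Proof.
move=> [[_ f_inj _] _] x.
by apply: (pinvKV _ f_inj); rewrite inE.
Qed.

Lemma inv_opVK {X : hilbertType C} (f : X -> X) :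
  boundedly_invertible (total_op f) -> cancel (inv_op (total_op f)) f.
Proof.
move=> [[_ _ f_surj] _] x.
by apply: (surjpK _ f_surj); rewrite inE.
Qed.

Lemma inv_op_linear {X : hilbertType C} (f : {linear X -> X}) :
  boundedly_invertible (total_op f) -> linear (inv_op (total_op f)).
Proof.
move=> f_inv a x y; apply: (can_inj (inv_opK f_inv)).
by rewrite linearP !inv_opVK.
Qed.

(* If no adjoint existed, [adjoint f] would be the default value [0], and
   coercivity would force the space to be trivial. *)
Lemma adjointP_coercive {X : hilbertType C} (f q : X -> X) :
  coercive (adjoint f \o q) -> adjoint_pair f (adjoint f).
Proof.
move=> [_ _ [k k0 kP]].
have [ex|nex] := pselect (exists g, adjoint_pair f g).
  exact: (xgetPex (fun=> 0) ex).
have adj0 : adjoint f = fun=> 0 by apply: xgetPN => g fg; apply: nex; exists g.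
have X0 (x : X) : x = 0.
  have := kP x; rewrite adj0 /= linear0l pmulr_rle0// => x0.
  by apply/eqP; rewrite -normr_eq0 -sqrf_eq0 eq_le x0 exprn_ge0.
by move=> x y; rewrite (X0 y) (X0 (adjoint f 0)) !linear0r.
Qed.
End Reduction.

(** * The reduced operator: well-definedness, linearity, dissipativity *)

Section ReducedOperator.
Context {C : numClosedFieldType} {X1 X2 : hilbertType C}
  {A : partial_op (hsum X1 X2) (hsum X1 X2)}
  {E1 Q1 : {linear X1 -> X1}} {Q2 : {linear X2 -> X2}}.
Hypotheses (A_lin : linear_op A) (E1_inv : boundedly_invertible (total_op E1))
  (Q2_inv : boundedly_invertible (total_op Q2))
  (hW : coercive (adjoint E1 \o Q1))
  (A2_inj : forall x2 : X2, opdom A (0, x2) -> (A (0, x2)).2 = 0 -> x2 = 0).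
Local Notation red := (red_pair A Q1 Q2).
Local Notation V := (inv_op (total_op E1)).

Lemma red_pair_linear a x1 x2 y1 y2 : red x1 x2 -> red y1 y2 ->
  red (a *: x1 + y1) (a *: x2 + y2) /\
  A (Q1 (a *: x1 + y1), Q2 (a *: x2 + y2)) =
    a *: A (Q1 x1, Q2 x2) + A (Q1 y1, Q2 y2).
Proof.
move=> [Dx Ax] [Dy Ay]; rewrite /red_pair.
have -> : (Q1 (a *: x1 + y1), Q2 (a *: x2 + y2)) =
    a *: ((Q1 x1, Q2 x2) : hsum X1 X2) + (Q1 y1, Q2 y2) by rewrite !linearP.
have [D E] := A_lin.2 a _ _ Dx Dy; split=> //; split=> //.
by rewrite E /= Ax Ay scaler0 addr0.
Qed.

(** The difference of the two pairs has first component 0, so [A2_inj] applies to its image under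
    [Q2], and [Q2] is injective. *)
Lemma red_pair_unique x1 x2 y2 : red x1 x2 -> red x1 y2 -> x2 = y2.
Proof.
move=> rx ry; have [] := red_pair_linear (-1) rx ry.
rewrite /red_pair scaleN1r addNr linear0 => -[D E] _.
have := A2_inj D E; rewrite -[X in _ = X](linear0 Q2) => /(can_inj (inv_opK Q2_inv)).
by rewrite scaleN1r addrC => /eqP; rewrite subr_eq0 => /eqP.
Qed.

(** By uniqueness, the component picked by [xget] is the given one; this is the well-definedness of
    [A_red]. *)
Lemma A_redE x1 x2 : red x1 x2 ->
  A_red A Q2 hW x1 = V (A (Q1 x1, Q2 x2)).1.
Proof.
move=> rx; rewrite /A_red /=; congr (V (A (_, Q2 _)).1).
by apply: xget_unique => // y ry; apply: red_pair_unique ry rx.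
Qed.

Lemma E1_A_red x1 x2 : red x1 x2 ->
  E1 (A_red A Q2 hW x1) = (A (Q1 x1, Q2 x2)).1.
Proof. by move=> rx; rewrite (A_redE rx) inv_opVK. Qed.

Lemma A_red_linear : linear_op (A_red A Q2 hW).
Proof.
split.
  exists 0; have [_ E] := A_lin.2 (-1) 0 0 A_lin.1 A_lin.1.
  rewrite scaler0 addr0 scaleN1r addNr in E.
  by rewrite /red_pair !linear0; split; [exact: A_lin.1|rewrite E].
move=> a x y [x2 rx] [y2 ry]; have [rxy E] := red_pair_linear a rx ry.
split; first by exists (a *: x2 + y2).
rewrite (A_redE rxy) (A_redE rx) (A_redE ry) E.
exact: (inv_op_linear E1_inv a (A (Q1 x, Q2 x2)).1 (A (Q1 y, Q2 y2)).1).
Qed.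

Lemma A_red_dissipative : dissipative A -> dissipative (A_red A Q2 hW).
Proof.
move=> A_diss x [x2 rx].
suff -> : inner (A_red A Q2 hW x) x =
    inner (A (Q1 x, Q2 x2)) ((Q1 x, Q2 x2) : hsum X1 X2) by apply: A_diss; case: rx.
rewrite (A_redE rx).
have -> : inner (A (Q1 x, Q2 x2)) ((Q1 x, Q2 x2) : hsum X1 X2) =
    inner (A (Q1 x, Q2 x2)).1 (Q1 x) + inner (A (Q1 x, Q2 x2)).2 (Q2 x2) by [].
(* The second component vanishes by the constraint; writing the first as [E1] of its preimage lets
   the adjoint carry [E1] across and produce the weight. *)
rewrite rx.2 linear0l addr0 -[in RHS](inv_opVK E1_inv (A _).1).
by rewrite (adjointP_coercive hW).
Qed.

End ReducedOperator.

(** * Range condition for the reduced operator and conclusion *)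

Lemma A_red_resolvent_onto {R : realType} {X1 X2 : hilbertType R[i]}
    {A : partial_op (hsum X1 X2) (hsum X1 X2)}
    {E1 Q1 : {linear X1 -> X1}} {Q2 : {linear X2 -> X2}}
    (hW : coercive (adjoint E1 \o Q1)) (s : R[i]) :
  linear_op A -> boundedly_invertible (total_op E1) ->
  boundedly_invertible (total_op Q2) ->
  (forall x2 : X2, opdom A (0, x2) -> (A (0, x2)).2 = 0 -> x2 = 0) ->
  boundedly_invertible (pencil s (block_diag E1 (fun=> 0))
    (comp_op A (block_diag Q1 Q2))) ->
  resolvent_onto (A := A_red A Q2 hW) s.
Proof.
move=> A_lin E1_inv Q2_inv A2_inj [[_ _ surj] _] f.
(* The zero entry turns the second row into the constraint defining the domain; the first row is
   [E1] applied to the resolvent equation. *)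
have [[x1 x2] Dx Ex] := surj (E1 f, 0) I.
have H1 : s *: E1 x1 - (A (Q1 x1, Q2 x2)).1 = E1 f by have := congr1 fst Ex.
have H2 : s *: 0 - (A (Q1 x1, Q2 x2)).2 = 0 by have := congr1 snd Ex.
have rx : red_pair A Q1 Q2 x1 x2.
  split; first exact: Dx.
  by move/eqP: H2; rewrite scaler0 sub0r oppr_eq0 => /eqP.
exists x1; split; first by exists x2.
apply: (can_inj (inv_opK E1_inv)).
rewrite -H1 -(E1_A_red A_lin E1_inv Q2_inv hW A2_inj rx).
by rewrite -linearZ -linearB.
Qed.

Theorem theorem25 (R : realType) (X1 X2 : hilbertType R[i])
    (A : partial_op (hsum X1 X2) (hsum X1 X2))
    (E1 Q1 : {linear X1 -> X1}) (Q2 : {linear X2 -> X2})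
    (A_linear : linear_op A) (A_dissipative : dissipative A)
    (E1_bounded : bounded_op E1) (E1_inv : boundedly_invertible (total_op E1))
    (Q1_bounded : bounded_op Q1) (Q1_inv : boundedly_invertible (total_op Q1))
    (Q2_bounded : bounded_op Q2) (Q2_inv : boundedly_invertible (total_op Q2))
    (E1Q1_coercive : coercive (adjoint E1 \o Q1))
    (EAQ_regular : regular (block_diag E1 (fun=> 0))
                           (comp_op A (block_diag Q1 Q2)))
    (A2_inj : forall x2 : X2,
       opdom A (0, x2) -> (A (0, x2)).2 = 0 -> x2 = 0) :
  (forall (x1 : X1) (x2 : X2), red_pair A Q1 Q2 x1 x2 ->
     A_red A Q2 E1Q1_coercive x1 = inv_op (total_op E1) (A (Q1 x1, Q2 x2)).1) /\
  generates_contraction_semigroup (A_red A Q2 E1Q1_coercive).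
Proof.
split; first by move=> x1 x2; apply: A_redE.
have red_lin := A_red_linear A_linear E1_inv Q2_inv E1Q1_coercive A2_inj.
have red_diss : dissipative (A_red A Q2 E1Q1_coercive) by apply: A_red_dissipative.
apply: lumer_phillips => // r r0.
(* Regularity provides a single, possibly non-real [s], while [lumer_phillips] asks for all positive
   reals; propagation over the half-plane bridges the gap. *)
have [s s0 s_inv] := EAQ_regular.
apply: (resolvent_onto_half_plane red_lin red_diss (s := s)).
- by rewrite -ltcR complexRe.
- by [].
- exact: A_red_resolvent_onto s_inv.
Qed.
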